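(* Let $L \subset \mathbb{R}^2$ be a well-rounded lattice of rank $2$. Then there is a unique real number $x \in [0, 2-\sqrt{3}]$ such that $L$ is similar to the cyclic lattice $$M(x) = \begin{pmatrix} 1 & x \\ x & 1 \end{pmatrix} \mathbb{Z}^2 .$$ Further, if $K \subseteq \mathbb{R}$ is a subfield such that $L \subset K^2$, then $x \in K$.
   Context: Let $\|\cdot\|$ be the Euclidean norm on $\mathbb{R}^n$. For a lattice $L \subset \mathbb{R}^n$ of rank $n$, put $|L| = \min\{\|\boldsymbol{x}\| : \boldsymbol{x} \in L \setminus \{\boldsymbol{0}\}\}$ and $S(L) = \{\boldsymbol{x} \in L : \|\boldsymbol{x}\| = |L|\}$. The lattice $L$ is well-rounded if $\operatorname{span}_{\mathbb{R}} S(L) = \operatorname{span}_{\mathbb{R}} L$. Two lattices $L_1, L_2 \subset \mathbb{R}^n$ are similar if $L_2 = \alpha U L_1$ for some real $\alpha > 0$ and some real orthogonal $n \times n$ matrix $U$. A lattice $L \subset \mathbb{R}^n$ is cyclic if $\rho(L) = L$, where $\rho(c_1, c_2, \dots, c_n) = (c_n, c_1, \dots, c_{n-1})$. For a $2\times 2$ matrix $B$, $B\mathbb{Z}^2$ is the set of integer linear combinations of the columns of $B$. *)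

(* Defs.v *)
From HB Require Import structures.
From mathcomp Require Import all_boot all_order all_algebra.
From mathcomp Require Import all_classical all_reals.
Set Implicit Arguments.
Unset Strict Implicit.
Unset Printing Implicit Defensive.
Import Order.TTheory GRing.Theory Num.Theory.
Local Open Scope classical_set_scope.
Local Open Scope ring_scope.

(* The library's norm on matrices is the maximum norm. *)
Definition enorm (R : realType) (n : nat) (v : 'cV[R]_n) : R :=
  Num.sqrt (\sum_(i < n) v i 0 ^+ 2).

Definition zcol_span (R : realType) (n r : nat) (B : 'M[R]_(n, r)) :
    set 'cV[R]_n :=
  [set B *m map_mx intr z | z in [set: 'cV[int]_r]].

Definition lattice_of_rank (R : realType) (n r : nat) (L : set 'cV[R]_n) :
    Prop :=
  exists B : 'M[R]_(n, r), \rank B = r /\ L = zcol_span B.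

(* For a nonzero lattice this infimum is attained, hence is the minimum. *)
Definition min_norm (R : realType) (n : nat) (L : set 'cV[R]_n) : R :=
  inf [set enorm v | v in L `\ 0].

Definition min_vectors (R : realType) (n : nat) (L : set 'cV[R]_n) :
    set 'cV[R]_n :=
  [set v | L v /\ enorm v = min_norm L].

Definition lin_span (R : realType) (n : nat) (A : set 'cV[R]_n) :
    set 'cV[R]_n :=
  [set v | exists (k : nat) (c : 'I_k -> R) (a : 'I_k -> 'cV[R]_n),
     (forall i, A (a i)) /\ v = \sum_(i < k) c i *: a i].

Definition well_rounded (R : realType) (n : nat) (L : set 'cV[R]_n) : Prop :=
  lin_span (min_vectors L) = lin_span L.

Definition orthogonal_mx (R : realType) (n : nat) (U : 'M[R]_n) : Prop :=
  U^T *m U = 1%:M.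

Definition similar_lattices (R : realType) (n : nat) (L1 L2 : set 'cV[R]_n) : Prop :=
  exists (alpha : R) (U : 'M[R]_n),
    [/\ 0 < alpha, orthogonal_mx U & L2 = [set alpha *: (U *m v) | v in L1]].

(* Indices wrap around: [ord_pred] sends the index 0 to n - 1. *)
Definition rot_shift (R : realType) (n : nat) (v : 'cV[R]_n) : 'cV[R]_n :=
  \col_(i < n) v (ord_pred i) 0.

Definition cyclic_set (R : realType) (n : nat) (L : set 'cV[R]_n) : Prop :=
  @rot_shift R n @` L = L.

Definition cyclicM (R : realType) (x : R) : set 'cV[R]_2 :=
  zcol_span (\matrix_(i < 2, j < 2) (if i == j then 1 else x)).

(* Main.v *)
Require Import Defs.
From HB Require Import structures.
From mathcomp Require Import all_boot all_order all_algebra.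
From mathcomp Require Import all_classical all_reals.
From mathcomp Require Import ring lra.
Set Implicit Arguments.
Unset Strict Implicit.
Unset Printing Implicit Defensive.
Import Order.TTheory GRing.Theory Num.Theory.
Local Open Scope classical_set_scope.
Local Open Scope ring_scope.

(** Every well-rounded planar lattice has a basis of two minimal vectors [u] and
    [v]; after a change of sign its Gram matrix is
    [[g, h], [h, g]] with [0 <= 2 h <= g]. The basis of [cyclicM x] given by the
    columns [(1, x)] and [(x, 1)] has a Gram matrix of the same shape, with
    diagonal [1 + x^2] and off-diagonal [2 x], and the inequality
    [4 x <= 1 + x^2] holds on the whole interval [[0, 2 - sqrt 3]].

    Two facts turn the theorem into a computation with Gram matrices. First,
    lattices whose bases have proportional Gram matrices are similar, and a
    similarity transports a basis to one with a proportional Gram matrix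
    ([gram_similar], [similar_gram]). Second, such a reduced pair [(g, h)]
    depends on the lattice alone ([reduced_gram_unique]): [g] is the square of
    the minimal norm and [g^2 - h^2] the square of the covolume. So, for
    [x] in that interval, the lattice is similar to [cyclicM x] exactly when
    [2 x g = h (1 + x^2)]. If [h / g] is
    the cosine of the angle [t] between [u] and [v], this says
    [2 x / (1 + x^2) = cos t]; the two solutions have product 1 when [h] is
    nonzero, so at most one is less than 1, and it is
    [x = cos t / (1 + sin t) = h / (g + |det (u, v)|)].
    This last expression is rational in the coordinates of [u] and [v], up to
    the sign of the determinant, hence [x] lies in every field containing the
    coordinates of the lattice.

    The minimal vectors span the plane, hence contain a basis of the plane
    ([lin_span_basis]). That it generates the lattice is special to low
    dimension: subtracting from a lattice vector the nearest integer combination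
    of [u] and [v] leaves coefficients at most 1/2 in absolute value, and
    therefore a vector shorter than the minimal ones
    ([short_columns_generate]). *)

Section Lattices.
Variable R : realType.

(** * Matrices of order two *)

Lemma forall_I2 (P : 'I_2 -> Prop) : P 0 -> P 1 -> forall i, P i.
Proof.
by move=> P0 P1 [[|[|//]] Hi]; [move: P0 | move: P1]; congr P; apply/val_inj.
Qed.

Lemma sum_I2 (F : 'I_2 -> R) : \sum_(i < 2) F i = F 0 + F 1.
Proof.
rewrite big_ord_recl big_ord1; congr (_ + F _).
exact/val_inj.
Qed.

Lemma det_22 (A : 'M[R]_2) : \det A = A 0 0 * A 1 1 - A 1 0 * A 0 1.
Proof.
have lift01 (k : 'I_1) : lift (0 : 'I_2) k = 1 by rewrite ord1; apply/val_inj.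
have lift10 (k : 'I_1) : lift (1 : 'I_2) k = 0 by rewrite ord1; apply/val_inj.
rewrite (expand_det_col _ 0) sum_I2 /cofactor !det_mx11 !mxE ?lift01 ?lift10 /=.
by rewrite expr0 expr1; ring.
Qed.

Lemma det_gram (n : nat) (A : 'M[R]_n) : \det (A^T *m A) = \det A ^+ 2.
Proof. by rewrite det_mulmx det_tr. Qed.

(** * Norms and integer spans of columns *)

Lemma enorm_ge0 (n : nat) (v : 'cV[R]_n) : 0 <= enorm v.
Proof. exact: sqrtr_ge0. Qed.

Lemma enorm_sqr (n : nat) (v : 'cV[R]_n) : enorm v ^+ 2 = (v^T *m v) 0 0.
Proof.
rewrite sqr_sqrtr; last by apply: sumr_ge0 => i _; exact: sqr_ge0.
by rewrite mxE; apply: eq_bigr => i _; rewrite mxE expr2.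
Qed.

Lemma enorm_sqr_col (m n : nat) (P : 'M[R]_(m, n)) (j : 'I_n) :
  enorm (col j P) ^+ 2 = (P^T *m P) j j.
Proof. by rewrite enorm_sqr !mxE; apply: eq_bigr => i _; rewrite !mxE. Qed.

Lemma zcol_span_image (m n r : nat) (A : 'M[R]_(m, n)) (B : 'M[R]_(n, r)) :
  [set A *m v | v in zcol_span B] = zcol_span (A *m B).
Proof.
by rewrite /zcol_span image_comp; apply: eq_imagel => z _ /=; rewrite mulmxA.
Qed.

(** The columns of a generating matrix belong to the lattice; with
    [zcol_span_factor] this reduces inclusions of lattices to factorizations
    through integer matrices. *)
Lemma zcol_span_col (n r : nat) (B : 'M[R]_(n, r)) (j : 'I_r) :
  zcol_span B (col j B).
Proof. by exists (delta_mx j 0) => //; rewrite map_delta_mx -colE. Qed.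

Lemma zcol_span_factor (n r s : nat) (B : 'M[R]_(n, r)) (C : 'M[R]_(n, s)) :
  (forall j, zcol_span B (col j C)) ->
  exists Z : 'M[int]_(r, s), C = B *m map_mx intr Z.
Proof.
move=> /(_ _)/cid2-/all_sig2[z _ zE].
exists (\matrix_(i, j) z j i 0); apply/matrixP => i j.
have /colP/(_ i) := zE j; rewrite !mxE => <-.
by apply: eq_bigr => k _; rewrite !mxE.
Qed.

Lemma zcol_span_subset (n r s : nat) (B : 'M[R]_(n, r)) (C : 'M[R]_(n, s)) :
  (forall j, zcol_span B (col j C)) -> zcol_span C `<=` zcol_span B.
Proof.
move=> /zcol_span_factor[Z ->] _ [z _ <-].
by exists (Z *m z) => //; rewrite map_mxM mulmxA.
Qed.

Lemma zcol_spanB (n r : nat) (B : 'M[R]_(n, r)) v w :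
  zcol_span B v -> zcol_span B w -> zcol_span B (v - w).
Proof.
by move=> [a _ <-] [b _ <-]; exists (a - b) => //; rewrite map_mxB mulmxBr.
Qed.

Lemma sqr_intr_ge1 (k : int) : k != 0 -> 1 <= k%:~R ^+ 2 :> R.
Proof.
move=> k0; rewrite -real_normK ?num_real // exprn_ege1 //.
by apply: norm_intr_ge1; rewrite ?intr_eq0 // intr_int.
Qed.

(** The integer matrix through which a basis of the sublattice factors has a
    nonzero integer determinant, so the covolume can only grow. *)
Lemma sublattice_det (n : nat) (B C : 'M[R]_n) :
  zcol_span C `<=` zcol_span B -> \det C != 0 -> \det B ^+ 2 <= \det C ^+ 2.
Proof.
move=> CB; have [Z ->] : exists Z : 'M[int]_n, C = B *m map_mx intr Z.
  by apply: zcol_span_factor => j; apply/CB/zcol_span_col.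
rewrite det_mulmx det_map_mx mulf_eq0 negb_or intr_eq0 => /andP[_ Z0].
by rewrite exprMn ler_peMr ?sqr_ge0 // sqr_intr_ge1.
Qed.

(** * Similarity through Gram matrices *)

(** The matrix taking the columns of [P] to those of [Q], divided by [a], is
    orthogonal because it preserves the inner products of a basis. *)
Lemma gram_similar (n : nat) (P Q : 'M[R]_n) (a : R) :
  P \in unitmx -> 0 < a -> Q^T *m Q = a ^+ 2 *: (P^T *m P) ->
  similar_lattices (zcol_span P) (zcol_span Q).
Proof.
move=> Pu a0 QP; exists a, (a^-1 *: (Q *m invmx P)); split => //.
  rewrite /orthogonal_mx [(_ *: _)^T]linearZ /= trmx_mul.
  rewrite -scalemxAl -scalemxAr scalerA.
  rewrite mulmxA -(mulmxA _ Q^T) QP -scalemxAr -scalemxAl scalerA.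
  rewrite mulmxA -trmx_mul mulmxV // trmx1 mul1mx mulmxV //.
  rewrite (_ : _ * _ = 1) ?scale1r //; by field; rewrite gt_eqF.
under eq_imagel do rewrite -scalemxAl scalerA mulfV ?gt_eqF // scale1r.
by rewrite zcol_span_image mulmxKV.
Qed.

Lemma similar_gram (n r : nat) (P : 'M[R]_(n, r)) (L : set 'cV[R]_n) :
  similar_lattices (zcol_span P) L ->
  exists (a : R) (Q : 'M[R]_(n, r)),
    [/\ 0 < a, L = zcol_span Q & Q^T *m Q = a ^+ 2 *: (P^T *m P)].
Proof.
move=> [a [U [a0 Uo ->]]]; exists a, ((a *: U) *m P); split => //.
  by rewrite -zcol_span_image; apply: eq_imagel => v _; rewrite -scalemxAl.
rewrite trmx_mul mulmxA -(mulmxA P^T) [(_ *: _)^T]linearZ /= -scalemxAl.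
by rewrite -(scalemxAr a U^T) scalerA Uo -expr2 -scalemxAr -scalemxAl mulmx1.
Qed.

(** * Reduced bases in the plane *)

(** Gram matrices of two vectors of equal norm have this shape, and so does the
    basis that defines [cyclicM x]; hence one family serves both. *)
Definition sym2 (a b : R) : 'M[R]_2 :=
  \matrix_(i < 2, j < 2) (if i == j then a else b).

Lemma det_sym2 a b : \det (sym2 a b) = a ^+ 2 - b ^+ 2.
Proof. by rewrite det_22 !mxE /= !expr2. Qed.

Lemma det_gram_sym2 (P : 'M[R]_2) g h :
  P^T *m P = sym2 g h -> \det P ^+ 2 = g ^+ 2 - h ^+ 2.
Proof. by move=> GP; rewrite -det_sym2 -GP det_gram. Qed.

Lemma scale_sym2 c a b : c *: sym2 a b = sym2 (c * a) (c * b).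
Proof. by apply/matrixP; apply: forall_I2; apply: forall_I2; rewrite !mxE. Qed.

Lemma gram_sym2 a b : (sym2 a b)^T *m sym2 a b = sym2 (a ^+ 2 + b ^+ 2) (2 * a * b).
Proof.
by apply/matrixP; apply: forall_I2; apply: forall_I2;
  rewrite !mxE sum_I2 !mxE /=; ring.
Qed.

Lemma enorm_sqr_sym2 (P : 'M[R]_2) g h (z : 'cV[R]_2) : P^T *m P = sym2 g h ->
  enorm (P *m z) ^+ 2 =
  g * (z 0 0 ^+ 2 + z 1 0 ^+ 2) + 2 * h * (z 0 0 * z 1 0).
Proof.
move=> PP; rewrite enorm_sqr trmx_mul mulmxA -(mulmxA z^T) PP.
by rewrite mxE sum_I2 !mxE !sum_I2 !mxE /=; ring.
Qed.

(** Reducedness makes the diagonal entry the minimum of the quadratic form over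
    nonzero integer vectors. If both coordinates are nonzero, the form is
    [(g - h) (a^2 + b^2) + h (a + b)^2], at least [2 (g - h)], which is at
    least [g]. *)
Lemma sym2_min (g h : R) (a b : int) : 0 <= h -> 2 * h <= g ->
  (a != 0) || (b != 0) ->
  g <= g * (a%:~R ^+ 2 + b%:~R ^+ 2) + 2 * h * (a%:~R * b%:~R).
Proof.
move=> h0 hg.
case: (eqVneq a 0) => [->|/sqr_intr_ge1 a1];
  case: (eqVneq b 0) => [->|/sqr_intr_ge1 b1] //= _.
- by nra.
- by nra.
- by have := sqr_ge0 (a%:~R + b%:~R : R); nra.
Qed.

(** Both invariants are obtained as inequalities from one inclusion of lattices,
    and the other inclusion reverses them: [g] is the least squared norm of a
    nonzero vector, and [g^2 - h^2] the squared covolume. *)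
Lemma reduced_gram_unique (P Q : 'M[R]_2) (g h g' h' : R) :
  zcol_span P = zcol_span Q ->
  P^T *m P = sym2 g h -> Q^T *m Q = sym2 g' h' ->
  0 < g -> 0 <= h -> 2 * h <= g -> 0 < g' -> 0 <= h' -> 2 * h' <= g' ->
  g = g' /\ h = h'.
Proof.
suff main (P' Q' : 'M[R]_2) (a b a' b' : R) :
    zcol_span P' = zcol_span Q' ->
    P'^T *m P' = sym2 a b -> Q'^T *m Q' = sym2 a' b' ->
    0 < a -> 0 <= b -> 2 * b <= a -> 0 < a' -> 0 <= b' -> 2 * b' <= a' ->
    a <= a' /\ a ^+ 2 - b ^+ 2 <= a' ^+ 2 - b' ^+ 2.
  move=> PQ GP GQ g0 h0 hg g0' h0' hg'.
  have [le1 le2] := main _ _ _ _ _ _ PQ GP GQ g0 h0 hg g0' h0' hg'.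
  have [le3 le4] := main _ _ _ _ _ _ (esym PQ) GQ GP g0' h0' hg' g0 h0 hg.
  have eg : g = g' by lra.
  split=> //; apply/eqP; rewrite -(eqrXn2 (n := 2)) //; apply/eqP.
  rewrite eg in le2 le4; lra.
move=> PQ GP GQ a0 b0 ab a0' b0' ab'; split.
  have [z _ zE] : zcol_span P' (col 0 Q') by rewrite PQ; exact: zcol_span_col.
  have nQ : enorm (col 0 Q') ^+ 2 = a'.
    by rewrite enorm_sqr_col GQ mxE.
  rewrite -nQ -zE (enorm_sqr_sym2 _ GP) !mxE; apply: sym2_min => //.
  apply: contraTT (a0'); rewrite negb_or !negbK => /andP[/eqP z0 /eqP z1].
  by rewrite -nQ -zE (enorm_sqr_sym2 _ GP) !mxE z0 z1; nra.
rewrite -(det_gram_sym2 GP) -(det_gram_sym2 GQ); apply: sublattice_det.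
  by rewrite PQ.
by rewrite -sqrf_eq0 (det_gram_sym2 GQ); apply/eqP; nra.
Qed.

(** * Bases made of minimal vectors *)

Lemma lin_span_functional (n : nat) (A : set 'cV[R]_n) (c : 'rV[R]_n) w :
  lin_span A w -> c *m w != 0 -> exists2 a, A a & c *m a != 0.
Proof.
move=> [k [t [a [Aa ->]]]]; apply: contraNP => /forall2NP noA; apply/eqP.
rewrite mulmx_sumr big1 // => i _; rewrite -scalemxAr.
by have [/(_ (Aa i))//|/negP/negPn/eqP->] := noA (a i); rewrite scaler0.
Qed.

(** Steinitz exchange, one column at a time. As a function of its [j]-th column
    the determinant is the linear functional given by row [j] of the adjugate;
    it does not vanish on the current column, which lies in the span of [A], so
    it does not vanish on some element of [A]. *)
Lemma lin_span_basis (n : nat) (A : set 'cV[R]_n) (B : 'M[R]_n) :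
  (forall j, lin_span A (col j B)) -> \det B != 0 ->
  exists2 P : 'M[R]_n, \det P != 0 & forall j, A (col j P).
Proof.
move=> AB B0; suff /(_ n (leqnn n))[P [P0 AP _]] : forall k, (k <= n)%N ->
    exists P : 'M[R]_n, [/\ \det P != 0, forall j : 'I_n, (j < k)%N -> A (col j P)
      & forall j : 'I_n, (k <= j)%N -> lin_span A (col j P)].
  by exists P => // j; exact: AP.
elim=> [|k IHk] kn; first by exists B; split.
have [P [P0 AP spanP]] := IHk (ltnW kn); pose j := Ordinal kn.
have [||a Aa ca] := @lin_span_functional _ A (row j (\adj P)) (col j P).
- exact: spanP.
- apply: contra P0 => /eqP/matrixP/(_ 0 0).
  rewrite !mxE => cP; rewrite (expand_det_col _ j).
  by apply/eqP; rewrite -[RHS]cP; apply: eq_bigr => i _; rewrite !mxE mulrC.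
exists (\matrix_(i, l) if l == j then a i 0 else P i l); split.
- apply: contra ca => /eqP; rewrite (expand_det_col _ j) => cP.
  apply/eqP/matrixP => i0 j0; rewrite !ord1 !mxE -[RHS]cP.
  apply: eq_bigr => i _; rewrite !mxE eqxx mulrC; congr (_ * (_ * \det _)).
  by apply/matrixP => i1 j1; rewrite !mxE eq_sym (negbTE (neq_lift _ _)).
- move=> l lk; case: (eqVneq l j) => [->|lj].
    rewrite (_ : col _ _ = a) //.
    by apply/colP => i; rewrite !mxE eqxx.
  rewrite (_ : col _ _ = col l P); last by apply/colP => i; rewrite !mxE (negbTE lj).
  by apply: AP; rewrite ltn_neqAle -ltnS lk andbT.
- move=> l kl; rewrite (_ : col _ _ = col l P); first exact/spanP/ltnW.
  apply/colP => i; rewrite !mxE ifN //.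
  by apply: contraTneq kl => ->; rewrite ltnn.
Qed.

Lemma min_norm_le (n : nat) (L : set 'cV[R]_n) w :
  L w -> w != 0 -> min_norm L <= enorm w.
Proof.
move=> Lw w0; apply: ge_inf; first by exists 0 => _ [v _ <-]; exact: enorm_ge0.
by exists w => //; split => //; exact/eqP.
Qed.

Lemma nearest_int (a : R) : exists k : int, `|a - k%:~R| <= 2^-1.
Proof.
exists (Num.floor (a + 2^-1)).
have := floor_itv (a + 2^-1); rewrite intrD ler_norml => /andP[].
by move=> ? ?; apply/andP; split; lra.
Qed.

(** A lattice vector minus the nearest integer combination of the columns has
    coefficients [a] and [b] at most 1/2 in absolute value. By the strict
    Cauchy-Schwarz inequality [|h| < g] its squared norm is less than
    [g (|a| + |b|)^2], hence than [g], when [a b] is nonzero, and at most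
    [g / 2] otherwise; so it is zero. *)
Lemma short_columns_generate (L : set 'cV[R]_2) (B P : 'M[R]_2) (g h : R) :
  L = zcol_span B -> (forall j, L (col j P)) -> \det P != 0 ->
  P^T *m P = sym2 g h -> (forall w, L w -> w != 0 -> g <= enorm w ^+ 2) ->
  L = zcol_span P.
Proof.
move=> LB LP P0 GP gmin; apply/seteqP; split; last first.
  by rewrite LB; apply: zcol_span_subset => j; rewrite -LB.
move=> w Lw; have Pu : P \in unitmx by rewrite unitmxE unitfE.
have dG0 : 0 < g ^+ 2 - h ^+ 2 by rewrite -(det_gram_sym2 GP) exprn_even_gt0.
have g0 : 0 <= g.
  have <- : enorm (col 0 P) ^+ 2 = g by rewrite enorm_sqr_col GP mxE.
  exact: sqr_ge0.
have [c wP] : exists c : 'cV_2, w = P *m c.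
  by exists (invmx P *m w); rewrite mulmxA mulmxV // mul1mx.
have [k0 Hk0] := nearest_int (c 0 0); have [k1 Hk1] := nearest_int (c 1 0).
pose z : 'cV[int]_2 := \col_i (if i == 0 then k0 else k1).
suff : w - P *m map_mx intr z == 0.
  by rewrite subr_eq0 => /eqP ->; exists z.
have wE : w - P *m map_mx intr z = P *m (c - map_mx intr z).
  by rewrite wP mulmxBr.
apply: contraT => r0; exfalso.
have Lr : L (w - P *m map_mx intr z).
  rewrite LB; apply: zcol_spanB; first by rewrite -LB.
  have := @zcol_span_subset _ _ _ B P; apply; last by exists z.
  by move=> j; rewrite -LB.
have := gmin _ Lr r0; rewrite wE (enorm_sqr_sym2 _ GP) !mxE /=.
move: Hk0 Hk1; set a := _ - k0%:~R; set b := _ - k1%:~R.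
rewrite !ler_norml => /andP[a1 a2] /andP[b1 b2].
have g1 : 0 < g by nra.
have hg1 : h < g by nra.
have hg2 : - g < h by nra.
apply/negP; rewrite -ltNge.
have [ab|ab|ab] := ltgtP (a * b) 0.
- have hab : h * (a * b) < - g * (a * b) by rewrite ltr_nM2r.
  have : g * (a - b) ^+ 2 <= g by rewrite ler_piMr //; nra.
  rewrite sqrrB; lra.
- have hab : h * (a * b) < g * (a * b) by rewrite ltr_pM2r.
  have : g * (a + b) ^+ 2 <= g by rewrite ler_piMr //; nra.
  rewrite sqrrD; lra.
- have a2_le : a ^+ 2 <= 4^-1 by nra.
  have b2_le : b ^+ 2 <= 4^-1 by nra.
  by rewrite ab; nra.
Qed.

Lemma sub_lin_span (n : nat) (A : set 'cV[R]_n) : A `<=` lin_span A.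
Proof.
move=> v Av; exists 1, (fun=> 1), (fun=> v); split=> //.
by rewrite big_ord1 scale1r.
Qed.

Lemma min_vectorsN (n r : nat) (B : 'M[R]_(n, r)) v :
  min_vectors (zcol_span B) v -> min_vectors (zcol_span B) (- v).
Proof.
move=> [[z _ <-] vmin]; split.
  by exists (- z) => //; rewrite map_mxN mulmxN.
by rewrite -vmin /enorm; congr Num.sqrt; apply: eq_bigr => i _; rewrite mxE sqrrN.
Qed.

(** A negative inner product is corrected by changing the sign of the second
    vector. *)
Lemma min_vectors_pair (L : set 'cV[R]_2) :
  lattice_of_rank 2 L -> well_rounded L ->
  exists P : 'M[R]_2, [/\ \det P != 0, forall j, min_vectors L (col j P)
    & 0 <= (P^T *m P) 0 1].
Proof.
move=> [B [rB LB]] wr.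
have B0 : \det B != 0 by rewrite -unitfE -unitmxE -row_free_unit /row_free rB.
have [j|P P0 SP] := @lin_span_basis 2 (min_vectors L) B _ B0.
  by rewrite wr; apply: sub_lin_span; rewrite LB; exact: zcol_span_col.
have [h0|h0] := leP 0 ((P^T *m P) 0 1); first by exists P.
pose P' : 'M[R]_2 := \matrix_(i, j) (if j == 0 then P i j else - P i j).
exists P'; split.
- rewrite (_ : \det P' = - \det P) ?oppr_eq0 //.
  by rewrite !det_22 !mxE /=; ring.
- apply: forall_I2.
    by rewrite (_ : col 0 P' = col 0 P) //; apply/colP => i; rewrite !mxE.
  rewrite (_ : col 1 P' = - col 1 P); last by apply/colP => i; rewrite !mxE.
  by move: (SP 1); rewrite LB; exact: min_vectorsN.
- by move: h0; rewrite !mxE !sum_I2 !mxE /=; lra.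
Qed.

(** With [h >= 0], the bound [2 h <= g] says that the difference of the two
    basis vectors, of squared norm [2 g - 2 h], is not shorter than the minimum. *)
Lemma well_rounded_reduced_basis (L : set 'cV[R]_2) :
  lattice_of_rank 2 L -> well_rounded L ->
  exists (P : 'M[R]_2) (g h : R),
    [/\ L = zcol_span P, P^T *m P = sym2 g h, 0 < g, 0 <= h & 2 * h <= g].
Proof.
move=> rL wr; have [P [P0 SP h0]] := min_vectors_pair rL wr.
have [B [_ LB]] := rL.
pose g := min_norm L ^+ 2; pose h := (P^T *m P) 0 1.
have GP : P^T *m P = sym2 g h.
  apply/matrixP; apply: forall_I2; apply: forall_I2; rewrite [RHS]mxE //=.
  - by rewrite -enorm_sqr_col (SP 0).2.
  - by rewrite /h !mxE; apply: eq_bigr => i _; rewrite !mxE mulrC.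
  - by rewrite -enorm_sqr_col (SP 1).2.
have min0 : 0 <= min_norm L by rewrite -(SP 0).2 enorm_ge0.
have gmin w : L w -> w != 0 -> g <= enorm w ^+ 2.
  by move=> Lw w0; rewrite lerXn2r ?nnegrE ?enorm_ge0 // min_norm_le.
have LP j : L (col j P) by exact: (SP j).1.
(* The minimum is an infimum, a priori possibly zero: that would force both
   minimal vectors to vanish, and with them the determinant. *)
have dG0 : 0 < g ^+ 2 - h ^+ 2 by rewrite -(det_gram_sym2 GP) exprn_even_gt0.
have g0 : 0 < g by have : 0 <= g by [exact: sqr_ge0]; nra.
exists P, g, h; split => //.
  exact: short_columns_generate LB LP P0 GP gmin.
pose z : 'cV[R]_2 := \col_i (if i == 0 then 1 else -1).
have Pz : P *m z = col 0 P - col 1 P.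
  by apply/colP => i; rewrite !mxE sum_I2 !mxE /=; ring.
have nPz : enorm (P *m z) ^+ 2 = 2 * g - 2 * h.
  by rewrite (enorm_sqr_sym2 _ GP) !mxE /=; ring.
suff : g <= enorm (P *m z) ^+ 2 by rewrite nPz; lra.
apply: gmin; first by rewrite Pz LB; apply: zcol_spanB; rewrite -LB.
(* If the difference vanished, then [h = g] and the Gram determinant would be 0. *)
apply: contraTneq dG0 => Pz0; move: nPz; rewrite Pz0 enorm_sqr mulmx0 mxE => gh.
by rewrite -leNgt; nra.
Qed.

(** * The lattices [cyclicM x] *)

Lemma cyclicM_sym2 (x : R) : cyclicM x = zcol_span (sym2 1 x).
Proof. by []. Qed.

Lemma cyclicM_rank (x : R) : 0 <= x < 1 -> lattice_of_rank 2 (cyclicM x).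
Proof.
move=> /andP[x0 x1]; exists (sym2 1 x); split => //; apply: mxrank_unit.
by rewrite unitmxE unitfE det_sym2; apply/eqP; nra.
Qed.

(** The generating matrix is circulant, so rotating a vector amounts to rotating
    its integer coordinates, and the rotation is an involution in dimension two. *)
Lemma cyclicM_cyclic (x : R) : cyclic_set (cyclicM x).
Proof.
pose swap (z : 'cV[int]_2) : 'cV[int]_2 := \col_i z (ord_pred i) 0.
have p0 : ord_pred (0 : 'I_2) = 1 by exact/val_inj.
have p1 : ord_pred (1 : 'I_2) = 0 by exact/val_inj.
have swapE z : rot_shift (sym2 1 x *m map_mx intr z) =
               sym2 1 x *m map_mx intr (swap z).
  apply/colP; apply: forall_I2; rewrite !mxE !sum_I2 !mxE /= ?p0 ?p1 /=; ring.
have swapK z : swap (swap z) = z.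
  by apply/colP; apply: forall_I2; rewrite !mxE ?p0 ?p1 ?p0.
rewrite /cyclic_set; apply/seteqP; split => v.
  by move=> [_ [z _ <-] <-]; rewrite swapE; exists (swap z).
move=> [z _ <-]; exists (sym2 1 x *m map_mx intr (swap z)).
  by exists (swap z).
by rewrite swapE swapK.
Qed.

(** [2 - sqrt 3] is the smaller root of [y^2 - 4 y + 1], so the second bound says
    that the standard basis of [cyclicM y] is reduced. *)
Lemma cyclicM_param_bounds (y : R) :
  0 <= y <= 2 - Num.sqrt 3 -> y < 1 /\ 4 * y <= 1 + y ^+ 2.
Proof.
have s0 : 0 <= Num.sqrt 3 :> R by exact: sqrtr_ge0.
have s3 : Num.sqrt 3 ^+ 2 = 3 :> R by rewrite sqr_sqrtr.
move=> /andP[y0 y1]; have s1 : 1 < Num.sqrt 3 :> R by nra.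
by split; [lra | nra].
Qed.

(** A similarity preserves the ratio of the two entries of the reduced Gram
    matrix; for [cyclicM y] this ratio is [2 y / (1 + y^2)]. *)
Lemma similar_cyclicM_ratio (P : 'M[R]_2) (g h y : R) :
  P^T *m P = sym2 g h -> 0 < g -> 0 <= h -> 2 * h <= g ->
  0 <= y <= 2 - Num.sqrt 3 -> similar_lattices (zcol_span P) (cyclicM y) ->
  2 * y * g = h * (1 + y ^+ 2).
Proof.
move=> GP g0 h0 hg yI /similar_gram[a [Q [a0 MQ GQ]]].
have [y1 y4] := cyclicM_param_bounds yI; move/andP: yI => [y0 _].
have a2 : 0 < a ^+ 2 by exact: exprn_gt0.
rewrite GP scale_sym2 in GQ.
by have [||||||e1 e2] := reduced_gram_unique MQ (gram_sym2 1 y) GQ; nra.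
Qed.

(** The equations say that [2 x / (1 + x^2)] and [2 y / (1 + y^2)] are equal,
    and eliminating [h] gives [(x - y) (1 - x y) = 0]. *)
Lemma ratio_unique (g h x y : R) : 0 < g ->
  0 <= x < 1 -> 0 <= y < 1 ->
  2 * x * g = h * (1 + x ^+ 2) -> 2 * y * g = h * (1 + y ^+ 2) -> x = y.
Proof.
move=> g0 /andP[x0 x1] /andP[y0 y1] ex ey.
have : g * ((x - y) * (1 - x * y)) = 0.
  have : (2 * x * g) * (1 + y ^+ 2) = (2 * y * g) * (1 + x ^+ 2).
    by rewrite ex ey; ring.
  by move=> e; lra.
move/eqP; rewrite !mulf_eq0 gt_eqF //= subr_eq0 => /orP[/eqP//|/eqP]; nra.
Qed.

(** Since [2 h <= g] forces [2 d >= sqrt 3 g], the quotient is at most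
    [1 / (2 + sqrt 3)], which is [2 - sqrt 3]. *)
Lemma half_angle_range (g h d : R) : 0 < g -> 0 <= h -> 2 * h <= g -> 0 <= d ->
  d ^+ 2 = g ^+ 2 - h ^+ 2 -> 0 <= h / (g + d) <= 2 - Num.sqrt 3.
Proof.
move=> g0 h0 hg d0 dE.
have s0 : 0 <= Num.sqrt 3 :> R by exact: sqrtr_ge0.
have s3 : Num.sqrt 3 ^+ 2 = 3 :> R by rewrite sqr_sqrtr.
have gd : 0 < g + d by lra.
rewrite divr_ge0 ?(ltW gd) //= ler_pdivrMr //.
have s2 : Num.sqrt 3 <= 2 :> R by nra.
have dge : Num.sqrt 3 * g <= 2 * d.
  have pos : (Num.sqrt 3 * g) ^+ 2 <= (2 * d) ^+ 2 by rewrite !exprMn s3 dE; nra.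
  by rewrite -(@ler_pXn2r _ 2) // nnegrE; nra.
by nra.
Qed.

(** With [h = g cos t] and [d = g sin t], this is the half-angle formula
    [2 w / (1 + w^2) = cos t] for [w = cos t / (1 + sin t)]. *)
Lemma half_angle_ratio (g h d : R) : 0 < g -> 0 <= d ->
  d ^+ 2 = g ^+ 2 - h ^+ 2 ->
  2 * (h / (g + d)) * g = h * (1 + (h / (g + d)) ^+ 2).
Proof.
move=> g0 d0 dE; have gd : g + d != 0 by rewrite gt_eqF //; lra.
have -> : h * (1 + (h / (g + d)) ^+ 2) = h * ((g + d) ^+ 2 + h ^+ 2) / (g + d) ^+ 2.
  by field.
have -> : (g + d) ^+ 2 + h ^+ 2 = 2 * g * (g + d).
  by have -> : h ^+ 2 = g ^+ 2 - d ^+ 2 by [lra]; ring.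
by field.
Qed.

End Lattices.

Theorem theorem1p1 (R : realType) (L : set 'cV[R]_2)
    (HL : lattice_of_rank 2 L) (HwrL : well_rounded L) :
  exists x : R,
    [/\ unique (fun y : R =>
          0 <= y <= 2 - Num.sqrt 3 /\ similar_lattices L (cyclicM y)) x,
        lattice_of_rank 2 (cyclicM x),
        cyclic_set (cyclicM x)
      & forall K : divringClosed R,
          (forall v : 'cV[R]_2, L v -> forall i : 'I_2, v i 0 \in K) ->
          x \in K].
Proof.
have [P [g [h [LP GP g0 h0 hg]]]] := well_rounded_reduced_basis HL HwrL.
pose d := `|\det P|.
have d0 : 0 <= d by exact: normr_ge0.
have dE : d ^+ 2 = g ^+ 2 - h ^+ 2.
  by rewrite real_normK ?num_real // (det_gram_sym2 GP).
pose x := h / (g + d).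
have xI : 0 <= x <= 2 - Num.sqrt 3 by exact: half_angle_range.
have xr : 2 * x * g = h * (1 + x ^+ 2) by exact: half_angle_ratio.
have [x1 _] := cyclicM_param_bounds xI; have /andP[x0 _] := xI.
have lt1 (y : R) : 0 <= y <= 2 - Num.sqrt 3 -> 0 <= y < 1.
  by move=> yI; have [-> _] := cyclicM_param_bounds yI; case/andP: yI => ->.
exists x; split.
- split; last first.
    move=> y [yI]; rewrite LP => sim.
    apply: (ratio_unique g0 (lt1 _ xI) (lt1 _ yI) xr).
    exact: similar_cyclicM_ratio GP g0 h0 hg yI sim.
  split => //; rewrite LP cyclicM_sym2.
  have a0 : 0 < (1 + x ^+ 2) / g by rewrite divr_gt0 //; nra.
  apply: (@gram_similar _ _ _ _ (Num.sqrt ((1 + x ^+ 2) / g))).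
  + by rewrite unitmxE unitfE -sqrf_eq0 (det_gram_sym2 GP); apply/eqP; nra.
  + by rewrite sqrtr_gt0.
  + rewrite sqr_sqrtr ?ltW // GP gram_sym2 scale_sym2; congr sym2.
      by rewrite expr1n; field; rewrite gt_eqF.
    rewrite mulr1 mulrAC [_ * h]mulrC -xr; by field; rewrite gt_eqF.
- exact/cyclicM_rank/lt1.
- exact: cyclicM_cyclic.
- move=> K LK.
  have PK i j : P i j \in K.
    have := LK (col j P) _ i; rewrite mxE; apply; rewrite LP; exact: zcol_span_col.
  have GK i j : (P^T *m P) i j \in K.
    by rewrite mxE rpred_sum // => k _; rewrite mxE rpredM.
  have gK : g \in K by have := GK 0 0; rewrite GP mxE.
  have hK : h \in K by have := GK 0 1; rewrite GP mxE.
  have dK : d \in K.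
    have detK : \det P \in K by rewrite det_22 rpredB ?rpredM.
    by rewrite /d; case: (ler0P (\det P)); rewrite ?rpredN.
  by rewrite rpred_div ?rpredD.
Qed.
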